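(* Let $d=2$, $n=3$, $X_1=(0,1)$, $X_2=(\frac{\sqrt3}{2},-\frac12)$, $X_3=(-\frac{\sqrt3}{2},-\frac12)$, $\sigma^2=3/(\log 256)$ and $\Sigma_1=\Sigma_2=\Sigma_3=\sigma^2I_2$. Then the problem of maximizing $\ell_3(G)=\frac13\sum_{i=1}^3\log f_{G,\Sigma_i}(X_i)$ over $G\in\mathcal{P}(\mathbb{R}^2)$ has infinitely many solutions; specifically, for every $\alpha\in[0,1]$ the measure $$\widehat G=\alpha\,\delta_0+(1-\alpha)\frac13\sum_{i=1}^3\delta_{X_i/2}$$ is a maximizer.
   Context: $\mathcal{P}(\mathbb{R}^2)$ is the set of all Borel probability measures on $\mathbb{R}^2$, $\delta_a$ is the point mass at $a$, $I_2$ is the $2\times2$ identity matrix, and $\log$ is the natural logarithm. For a symmetric positive-definite matrix $\Sigma$, $\varphi_\Sigma(x)=\det(2\pi\Sigma)^{-1/2}\exp(-\frac12x^{\mathsf T}\Sigma^{-1}x)$ and $f_{G,\Sigma}(x):=\int\varphi_\Sigma(x-\theta)\,dG(\theta)$. *)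

(* Defs.v *)
(* MathComp / MathComp-Analysis. *)
From HB Require Import structures.
From mathcomp Require Import all_boot all_order all_algebra.
From mathcomp Require Import all_classical all_reals all_analysis.

Set Implicit Arguments.
Unset Strict Implicit.
Unset Printing Implicit Defensive.

Import Order.TTheory GRing.Theory Num.Theory.
Import numFieldNormedType.Exports.

Local Open Scope classical_set_scope.
Local Open Scope ring_scope.

(* R^d, as column vectors, with its Borel sigma-algebra. The library topology
   on matrices is that of the max norm, i.e. the usual topology of R^d. *)
Notation borelRd R d := (g_sigma_algebraType (@open 'cV[R]_d)).

Notation borel_prob R d := (probability (borelRd R d) R).

Section gaussian_mixture.
Context {R : realType} {d : nat}.

Definition gaussian_density (S : 'M[R]_d) (x : 'cV[R]_d) : R :=
  \det ((2 * pi) *: S) `^ (- 2^-1)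
  * expR (- 2^-1 * (x^T *m invmx S *m x) ord0 ord0).

Definition mixture_density (G : borel_prob R d) (S : 'M[R]_d)
    (x : 'cV[R]_d) : R :=
  \int[G]_theta gaussian_density S (x - (theta : 'cV[R]_d)).

Definition loglik (n : nat) (X : 'I_n -> 'cV[R]_d) (S : 'I_n -> 'M[R]_d)
    (G : borel_prob R d) : R :=
  n%:R^-1 * \sum_(i < n) ln (mixture_density G (S i) (X i)).

Definition maximizers (n : nat) (X : 'I_n -> 'cV[R]_d) (S : 'I_n -> 'M[R]_d) :
    set (borel_prob R d) :=
  [set G | forall H : borel_prob R d, loglik X S H <= loglik X S G].

(* A term of type [borel_prob R d] also carries arbitrary values on
   non-measurable sets. A measure in the usual sense is its restriction to the
   Borel sets (set to the default value 0 elsewhere), so distinct measures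
   must be counted through this map. *)
Definition on_borel (G : borel_prob R d) : set (borelRd R d) -> \bar R :=
  (G : set (borelRd R d) -> \bar R) \_ measurable.

End gaussian_mixture.

Section triangle.
Context {R : realType}.

Definition vec2 (a b : R) : 'cV[R]_2 := \col_(j < 2) [:: a; b]`_j.

(* The indices 1, 2, 3 are the elements 0, 1, 2 of 'I_3. *)
Definition triangle (i : 'I_3) : 'cV[R]_2 :=
  [:: vec2 0 1;
      vec2 (Num.sqrt 3 / 2) (- 2^-1);
      vec2 (- (Num.sqrt 3 / 2)) (- 2^-1)]`_i.

Definition sigma2 : R := 3 / ln 256.

Definition triangle_cov (i : 'I_3) : 'M[R]_2 := sigma2%:M.

Local Notation delta a := (@dirac _ (borelRd R 2) a R).

Definition Ghat (alpha : R) (A : set (borelRd R 2)) : \bar R :=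
  (alpha%:E * delta (0 : 'cV[R]_2)%R A
   + (1 - alpha)%R%:E
     * ((3^-1)%R%:E * \sum_(i < 3) delta (2^-1 *: triangle i)%R A))%E.

End triangle.

(* Main.v *)
(* A Gaussian mixture likelihood is maximized by [G] as soon as the sum of the
   three densities [phi_i theta := phi (X_i - theta)], each divided by
   [f_G (X_i)], is at most 3 for every [theta]: integrate this against an
   arbitrary [H] and use [ln y <= y - 1]. Here [f_G (X_i)] is the same number
   for all [i] and [alpha], so the claim is that [sum_i phi_i] attains its
   maximum both at [0] and at the three points [X_i / 2]. In the variables
   [x_i = (8/3) ln 2 <X_i, theta>], whose sum is 0, this reads
   [sum_i exp x_i <= 3 exp (sum_i x_i^2 / (8 ln 2))]. With [x_1 = 2 s >= 0] and
   [x_2, x_3 = - s +- r], the inequality splits into one in [r] and one in [s].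
   Since [2 exp (- s) = exp (ln 2 - s)], the latter becomes even in
   [p = (3 s - ln 2) / 2] after division by a common factor; it then says that
   [cosh p * exp (- p^2 / (3 ln 2))] is maximal at [p = ln 2 / 2]. *)
Require Import Defs.
From mathcomp Require Import all_boot all_order all_algebra.
From mathcomp Require Import all_classical all_reals all_analysis.
From mathcomp Require Import measurable_realfun ring lra.

Import Order.TTheory GRing.Theory Num.Theory.
Import numFieldNormedType.Exports.

Local Open Scope classical_set_scope.
Local Open Scope ring_scope.

(** * Inequalities for hyperbolic functions and sums of exponentials *)

Section calculus.
Context {R : realType}.
Implicit Types (x y p q r s t a b c k : R) (f df : R -> R).

Lemma is_derive_ge0_le f df a b : a <= b ->
  (forall x, is_derive x 1 f (df x)) ->
  (forall x, a <= x <= b -> 0 <= df x) -> f a <= f b.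
Proof.
move=> ab fdf df0.
have [x|c] := MVT_segment ab (fun x _ => fdf x).
  apply: continuous_subspaceT => z; apply/differentiable_continuous.
  by apply/derivable1_diffP; case: (fdf z).
rewrite in_itv/= => /df0 dfc0 fab.
by rewrite -subr_ge0 fab mulr_ge0// subr_ge0.
Qed.

Lemma is_derive_le0_ge f df a b : a <= b ->
  (forall x, is_derive x 1 f (df x)) ->
  (forall x, a <= x <= b -> df x <= 0) -> f b <= f a.
Proof.
move=> ab fdf df0; rewrite -lerN2.
apply: (@is_derive_ge0_le (- f) (- df)) => // x axb.
by rewrite oppr_ge0 df0.
Qed.

Definition cosh x := (expR x + expR (- x)) / 2.
Definition sinh x := (expR x - expR (- x)) / 2.

#[local] Instance is_derive_cosh x : is_derive x 1 cosh (sinh x).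
Proof.
rewrite /cosh /sinh.
by apply: is_derive_eq; rewrite /GRing.scale/=; ring.
Qed.

#[local] Instance is_derive_sinh x : is_derive x 1 sinh (cosh x).
Proof.
rewrite /cosh /sinh.
by apply: is_derive_eq; rewrite /GRing.scale/=; ring.
Qed.

Lemma cosh0 : cosh 0 = 1.
Proof. by rewrite /cosh oppr0 expR0; field. Qed.

Lemma sinh0 : sinh 0 = 0.
Proof. by rewrite /sinh oppr0 expR0; field. Qed.

Lemma coshN x : cosh (- x) = cosh x.
Proof. by rewrite /cosh opprK addrC. Qed.

Lemma sinhD x y : sinh (x + y) = sinh x * cosh y + cosh x * sinh y.
Proof. by rewrite /cosh /sinh opprD !expRD; field. Qed.

Lemma sinhB x y : sinh (x - y) = sinh x * cosh y - cosh x * sinh y.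
Proof. by rewrite /cosh /sinh opprB addrC !expRD; field. Qed.

Lemma sinh_ge0 x : 0 <= x -> 0 <= sinh x.
Proof. by move=> x0; rewrite divr_ge0// subr_ge0 ler_expR; lra. Qed.

Lemma cosh_gt0 x : 0 < cosh x.
Proof. by rewrite divr_gt0// addr_gt0// expR_gt0. Qed.

Lemma cosh_homo p q : 0 <= p <= q -> cosh p <= cosh q.
Proof.
move=> /andP[p0 pq]; apply: (@is_derive_ge0_le _ sinh) => // x /andP[px _].
by rewrite sinh_ge0// (le_trans p0).
Qed.

Lemma cosh_ge1 x : 1 <= cosh x.
Proof.
wlog x0 : x / 0 <= x => [h|].
  by have [/h//|/ltW x0] := leP 0 x; rewrite -coshN h// oppr_ge0.
by rewrite -cosh0 cosh_homo// lexx.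
Qed.

(* The tangents to [expR] at [x] and at [- x], evaluated at [0]. *)
Lemma cosh_le1Mx x : cosh x <= 1 + x * sinh x.
Proof.
have tangent y : expR y * (1 - y) <= 1.
  by rewrite -[leRHS](expRxMexpNx_1 y) ler_wpM2l ?expR_ge0 ?expR_ge1Dx.
by have := tangent x; have := tangent (- x); rewrite /cosh /sinh; lra.
Qed.

Lemma sinh3_le y : 0 <= y -> 3 * sinh y <= y * (1 + 2 * cosh y).
Proof.
move=> y0; rewrite -subr_ge0.
have := @is_derive_ge0_le (fun x => x * (1 + 2 * cosh x) - 3 * sinh x)
  (fun x => 1 - cosh x + 2 * x * sinh x) 0 y y0.
rewrite sinh0 !(mul0r, mulr0) subr0; apply => x.
  by apply: is_derive_eq; rewrite /GRing.scale/=; ring.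
move=> /andP[x0 _]; have := cosh_le1Mx x.
by have := mulr_ge0 x0 (sinh_ge0 _ x0); lra.
Qed.

(** The ratio of the two sides is nonincreasing for [y >= 0], by [sinh3_le]. With the constant 1/3
    they agree to second order at 0. *)
Lemma cosh2_le_gauss y : 1 + 2 * cosh y <= 3 * expR (3^-1 * y ^+ 2).
Proof.
wlog y0 : y / 0 <= y => [h|].
  by have [/h//|/ltW y0] := leP 0 y; rewrite -coshN -sqrrN h// oppr_ge0.
rewrite -ler_pdivrMr ?expR_gt0// -expRN.
have := @is_derive_le0_ge (fun x => (1 + 2 * cosh x) * expR (- (3^-1 * x ^+ 2)))
  (fun x => 2 / 3 * (3 * sinh x - x * (1 + 2 * cosh x))
            * expR (- (3^-1 * x ^+ 2))) 0 y y0.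
have -> : (1 + 2 * cosh 0) * expR (- (3^-1 * 0 ^+ 2)) = 3.
  by rewrite cosh0 expr0n/= mulr0 oppr0 expR0; ring.
apply => x.
  by apply: is_derive_eq; rewrite /GRing.scale/=; field.
move=> /andP[x0 _]; rewrite mulr_le0_ge0 ?expR_ge0//.
by rewrite mulr_ge0_le0// subr_le0 sinh3_le.
Qed.

(** Convexity of [sinh] on the nonnegative half-line, with [sinh 0 = 0]; equivalently, [sinh x / x]
    is nondecreasing there. *)
Lemma sinhM_le t b : 0 <= t <= 1 -> 0 <= b -> sinh (t * b) <= t * sinh b.
Proof.
move=> /andP[t0 t1] b0; rewrite -subr_ge0.
have := @is_derive_ge0_le (fun x => t * sinh x - sinh (t * x))
  (fun x => t * (cosh x - cosh (t * x))) 0 b b0.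
rewrite !(mulr0, sinh0) subrr; apply => x.
  by apply: is_derive_eq; rewrite /GRing.scale/=; ring.
move=> /andP[x0 _]; rewrite mulr_ge0// subr_ge0 cosh_homo//.
by rewrite mulr_ge0// ler_piMl.
Qed.

(* [p * coth p] is nondecreasing because [sinh x / x] is, applied at [x = q - p]
   and [x = q + p]. *)
Lemma mul_coth_homo p q : 0 <= p <= q ->
  p * cosh p * sinh q <= q * cosh q * sinh p.
Proof.
move=> /andP[p0 pq]; have [q0|q0] := eqVneq q 0.
  have -> : p = q by lra.
  by rewrite mulrAC -subr_ge0; nra.
have qp : 0 < q + p by lra.
(* The addition formulas turn [(q + p) * sinh (q - p) <= (q - p) * sinh (q + p)] into twice the
   claim. *)
have := @sinhM_le ((q - p) / (q + p)) (q + p).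
rewrite divfK ?gt_eqF// divr_ge0 ?subr_ge0//; last exact: ltW.
rewrite ler_pdivrMr// mul1r => /(_ _ (ltW qp)).
rewrite mulrAC ler_pdivlMr// sinhB sinhD => h.
have /h : true && (q - p <= q + p) by apply/andP; split=> //; lra.
lra.
Qed.

(** The equation for [sinh a] makes [a] a critical point of [cosh x * expR (- (k * x ^+ 2))]. As
    [x * coth x] is nondecreasing, the derivative is nonnegative on [[0, a]] and nonpositive beyond
    [a]. *)
Lemma cosh_le_gauss a k p : 0 < a -> sinh a = 2 * k * a * cosh a -> 0 <= p ->
  cosh p * expR (- (k * p ^+ 2)) <= cosh a * expR (- (k * a ^+ 2)).
Proof.
move=> a0 sha p0.
pose df x := (sinh x - 2 * k * x * cosh x) * expR (- (k * x ^+ 2)).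
have dfE x : is_derive x 1 (fun x => cosh x * expR (- (k * x ^+ 2))) (df x).
  by rewrite /df; apply: is_derive_eq; rewrite /GRing.scale/=; ring.
have ac0 : 0 < a * cosh a by rewrite mulr_gt0// cosh_gt0.
have [pa|/ltW ap] := leP p a.
- have := is_derive_ge0_le _ _ _ _ pa dfE; apply => x /andP[px xa].
  rewrite mulr_ge0 ?expR_ge0// -(pmulr_rge0 _ ac0).
  have /mul_coth_homo : 0 <= x <= a by rewrite xa (le_trans p0).
  rewrite sha; lra.
- have := is_derive_le0_ge _ _ _ _ ap dfE; apply => x /andP[ax xp].
  rewrite mulr_le0_ge0 ?expR_ge0// -(pmulr_rle0 _ ac0).
  have /mul_coth_homo : 0 <= a <= x by rewrite ax ltW.
  rewrite sha; lra.
Qed.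

Lemma ln2_gt0 : 0 < ln 2 :> R.
Proof. by rewrite ln_gt0// ltr1n. Qed.

(** Follows from [2 <= (9/8) ^ 6] and [9/8 <= exp (1/8)]. It lets [1 / (4 * ln 2)] replace the
    smaller 1/3 in [cosh2_le_gauss]. *)
Lemma ln2_le : ln 2 <= 3 / 4 :> R.
Proof.
rewrite -ler_expR lnK ?posrE//.
have -> : 3 / 4 = 6%:R * 8^-1 :> R by field.
have h : 1 + 8^-1 <= expR 8^-1 :> R := expR_ge1Dx _.
rewrite expRM_natl (le_trans _ (lerXn2r 6 _ _ h)) ?nnegrE ?expR_ge0//; lra.
Qed.

Local Notation L := (@ln R 2).

Lemma cosh2_le_pow2 r : 1 + 2 * cosh r <= 3 * expR (r ^+ 2 / (4 * L)).
Proof.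
have L0 := ln2_gt0; have L1 := ln2_le.
apply: le_trans (cosh2_le_gauss r) _.
rewrite ler_pM2l// ler_expR mulrC ler_wpM2l ?sqr_ge0//.
by rewrite lef_pV2 ?posrE//; lra.
Qed.

(** Equality holds at [s = 0] and at [s = 2 / 3 * L], which correspond to [theta = 0] and
    [theta = X_1 / 2]. *)
Lemma isosceles_le s :
  expR (2 * s) + 2 * expR (- s) <= 3 * expR (3 * s ^+ 2 / (4 * L)).
Proof.
have L0 := ln2_gt0.
have e2 : expR L = 2 by rewrite lnK ?posrE.
pose b := expR (L / 2).
have b0 : b != 0 by rewrite gt_eqF ?expR_gt0.
have bb : b * b = 2 by rewrite -expRD -splitr e2.
have bV : expR (- (L / 2)) = b^-1 by rewrite expRN.
have key p : cosh p <= cosh (L / 2) * expR ((p ^+ 2 - (L / 2) ^+ 2) / (3 * L)).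
  wlog p0 : p / 0 <= p => [h|].
    by have [/h//|/ltW p0] := leP 0 p; rewrite -coshN -sqrrN h// oppr_ge0.
  (* The factor of [cosh (L / 2)] equals 1/3, and [tanh (ln 2 / 2) = (2 - 1) / (2 + 1)]. *)
  have sha : sinh (L / 2) = 2 * (3 * L)^-1 * (L / 2) * cosh (L / 2).
    rewrite /sinh /cosh bV -/b.
    have -> : b^-1 = b / 2 by rewrite -bb; field.
    by field; rewrite gt_eqF.
  have := @cosh_le_gauss (L / 2) (3 * L)^-1 p _ sha p0.
  rewrite divr_gt0// => /(_ isT).
  rewrite expRN ler_pdivrMr ?expR_gt0// -mulrA -expRD.
  by congr (_ <= _ * expR _); field; rewrite gt_eqF.
(* The exponents [2 * s] and [L - s] have mean [(s + L) / 2] and differ from it by [p] and [- p]. *)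
pose g := expR ((s + L) / 2); pose p := (3 * s - L) / 2.
have -> : expR (2 * s) + 2 * expR (- s) = 2 * g * cosh p.
  transitivity (g * expR p + g * expR (- p)); last by rewrite /cosh; field.
  by rewrite -{2}e2 -!expRD; congr (expR _ + expR _); rewrite /p; field.
have gE : g * expR ((p ^+ 2 - (L / 2) ^+ 2) / (3 * L)) =
    b * expR (3 * s ^+ 2 / (4 * L)).
  by rewrite -!expRD; congr expR; rewrite /p; field; rewrite gt_eqF.
have bch : 2 * b * cosh (L / 2) = 3.
  have -> : 2 * b * cosh (L / 2) = b * b + 1 by rewrite /cosh bV -/b; field.
  by rewrite bb; ring.
apply: le_trans (ler_wpM2l _ (key p)) _.
  by rewrite mulr_ge0// expR_ge0.
have -> : forall u v w x : R, u * v * (w * x) = u * w * (v * x).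
  by move=> *; ring.
by rewrite gE -bch; lra.
Qed.

Lemma sum_expR_le_gauss x y z : x + y + z = 0 ->
  expR x + expR y + expR z <=
  3 * expR ((x ^+ 2 + y ^+ 2 + z ^+ 2) / (8 * L)).
Proof.
have L0 := ln2_gt0.
(* Among three numbers with sum 0 one is nonnegative, and the claim is symmetric. The sign of [x]
   gives [expR (- s) <= 1] below. *)
wlog x0 : x y z / 0 <= x => [h|].
  move=> xyz; have [x0|x0] := leP 0 x; first exact: h.
  have [y0|y0] := leP 0 y.
    by rewrite -(addrC (expR y)) -(addrC (y ^+ 2)); apply: h; lra.
  have z0 : 0 <= z by lra.
  by rewrite -(addrC (expR z)) -(addrC (z ^+ 2)) !addrA; apply: h; lra.
move=> xyz; pose s := x / 2; pose r := (y - z) / 2.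
have -> : x = 2 * s by rewrite /s; field.
have -> : y = - s + r by rewrite /s /r; lra.
have -> : z = - s - r by rewrite /s /r; lra.
have -> : ((2 * s) ^+ 2 + (- s + r) ^+ 2 + (- s - r) ^+ 2) / (8 * L) =
    3 * s ^+ 2 / (4 * L) + r ^+ 2 / (4 * L) by field; rewrite gt_eqF.
have s0 : 0 <= s by rewrite /s; lra.
rewrite !expRD -addrA -mulrDr.
have -> : expR r + expR (- r) = 2 * cosh r by rewrite /cosh; field.
have := isosceles_le s; have := cosh2_le_pow2 r.
have := cosh_ge1 r.
have : expR (- s) <= 1 by rewrite -expR0 ler_expR; lra.
have := expR_gt0 (- s).
set e := expR (- s).
have : 1 <= expR (3 * s ^+ 2 / (4 * L)).
  by rewrite -[leLHS]expR0 ler_expR divr_ge0 ?mulr_ge0 ?sqr_ge0 ?(ltW L0).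
set E := expR _; set F := expR _; set C := cosh r => E1 e0 e1 C1 AF BE.
(* The left side is [expR (2 * s) + 2 * e + 2 * e * (C - 1)], bounded successively by
   [3 * E + 2 * (C - 1)], [3 * E + 3 * (F - 1)] and [3 * E * F]. *)
have h1 : e * (C - 1) <= C - 1 by rewrite ler_piMl ?subr_ge0.
have h2 : F - 1 <= E * (F - 1) by rewrite ler_peMl//; lra.
lra.
Qed.

End calculus.

(** * Borel measurability and integrals against a probability *)

Section measure.
Context {R : realType}.

Lemma borel_open (d : nat) (A : set (borelRd R d)) :
  open (A : set 'cV[R]_d) -> measurable A.
Proof. exact: sub_sigma_algebra. Qed.

Lemma continuous_borel_measurable (d : nat) (f : borelRd R d -> R) :
  continuous (f : 'cV[R]_d -> R) -> measurable_fun setT f.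
Proof.
move=> /continuousP cf; apply: (measurability _ (RGenOInfty.measurableE R)).
move=> _ [_ [x ->] <-]; rewrite setTI; apply: borel_open.
apply: cf; exact: rray_open.
Qed.

(** Normalizing a measure of mass 1 leaves it unchanged; the fallback [\d_point] only serves masses
    0 and infinity. *)
Lemma probability_measure d (T : measurableType d) (mu : measure T R) :
  mu setT = 1%E ->
  exists P : probability T R, (P : set T -> \bar R) = mu.
Proof.
move=> mu1; exists (mnormalize mu \d_point); apply/funext => A.
by rewrite /= /mnormalize mu1 onee_eq0 /= invr1 mule1.
Qed.

(** A zero integral would make [f] vanish almost everywhere, so the whole space would be a null
    set. *)
Lemma Rintegral_gt0 d (T : measurableType d) (P : probability T R)
    (f : T -> R) :
  P.-integrable setT (EFin \o f) -> (forall x, 0 < f x) -> 0 < \int[P]_x f x.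
Proof.
move=> fi f0; rewrite lt_neqAle Rintegral_ge0 ?andbT; last first.
  by move=> *; exact: ltW.
apply/negP => /eqP/esym intf0.
have [mf _] := integrableP _ _ _ fi.
have : (\int[P]_x `|(f x)%:E| = 0)%E.
  under eq_integral do rewrite gee0_abs ?lee_fin ?ltW//.
  rewrite -[LHS]fineK ?intf0//; first by rewrite (_ : fine _ = 0).
  exact: integrable_fin_num fi.
move/(ae_eq_integral_abs P measurableT mf) => [N [mN N0 subN]].
have : (P setT <= P N)%E.
  rewrite le_measure ?inE// => x _; apply: subN => /= /(_ I) [] /eqP.
  by rewrite gt_eqF.
by rewrite probability_setT N0 lee_fin ler10.
Qed.

Lemma Rintegral_sum d (T : measurableType d) (P : measure T R) (I : Type)
    (s : seq I) (f : I -> T -> R) :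
  (forall i, P.-integrable setT (EFin \o f i)) ->
  \int[P]_x (\sum_(i <- s) f i x) = \sum_(i <- s) \int[P]_x f i x.
Proof.
move=> fi; rewrite /Rintegral sum_fine; last first.
  by move=> i _; exact: integrable_fin_num (fi i).
rewrite -integral_sum//; congr fine.
by apply: eq_integral => x _; rewrite sumEFin.
Qed.

(* Strict positivity of [f i] matters: [ln] takes the junk value [ln 0 = 0]. *)
Lemma sum_ln_Rintegral_le d (T : measurableType d) (P : probability T R)
    (n : nat) (f : 'I_n -> T -> R) (c : R) : 0 < c ->
  (forall i, P.-integrable setT (EFin \o f i)) -> (forall i x, 0 < f i x) ->
  (forall x, \sum_i f i x <= n%:R * c) ->
  \sum_i ln (\int[P]_x f i x) <= n%:R * ln c.
Proof.
move=> c0 fi f0 fc.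
(* The tangent to [ln] at [c] lies above its graph. *)
have ln_le (y : R) : 0 < y -> ln y <= ln c + (y / c - 1).
  move=> y0; rewrite -lerBlDl -ln_div ?posrE//.
  have := @le_ln1Dx R (y / c - 1).
  rewrite addrCA subrr addr0; apply.
  by rewrite ltrBDr addrC subrr divr_gt0.
apply: (@le_trans _ _ (\sum_i (ln c + (\int[P]_x f i x / c - 1)))).
  by apply: ler_sum => i _; exact/ln_le/Rintegral_gt0.
rewrite !big_split/= -mulr_suml !sumr_const !card_ord.
rewrite [leRHS]mulr_natl gerDl mulNrn subr_le0 ler_pdivrMr// -Rintegral_sum//.
have cE : n%:R * c = \int[P]_x (n%:R * c).
  rewrite Rintegral_cst// -[LHS]mulr1; congr (_ * _).
  by rewrite -[LHS]/(fine 1); congr fine; exact/esym/probability_setT.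
rewrite cE; apply: le_Rintegral => //.
- under [X in _.-integrable _ X]funext => x do rewrite /= -sumEFin.
  by apply: integrable_sum => // i _; exact: fi.
- exact: finite_measure_integrable_cst.
Qed.

End measure.

(** * Gaussian densities with scalar covariance *)

Section gaussian.
Context {R : realType} {d : nat}.
Implicit Types (x theta : 'cV[R]_d) (v : R).

(** The squared Euclidean norm, as opposed to the max norm on matrices. *)
Definition sqnorm x : R := \sum_j x j ord0 ^+ 2.

Lemma sqnorm_ge0 x : 0 <= sqnorm x.
Proof. by apply: sumr_ge0 => j _; exact: sqr_ge0. Qed.

(** For [v > 0], the maximum of the density with covariance [v%:M], attained at 0. *)
Definition gaussian_peak v : R := ((2 * pi * v) ^+ d) `^ (- 2^-1).

Lemma gaussian_peak_gt0 v : 0 < v -> 0 < gaussian_peak v.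
Proof. by move=> v0; rewrite powR_gt0// exprn_gt0// !mulr_gt0// pi_gt0. Qed.

Lemma gaussian_density_scalar v x :
  gaussian_density v%:M x = gaussian_peak v * expR (- (2 * v)^-1 * sqnorm x).
Proof.
rewrite /gaussian_density /gaussian_peak scale_scalar_mx det_scalar.
rewrite invmx_scalar mul_mx_scalar -scalemxAl mxE mxE invfM mulrA -mulNr.
congr (_ * expR (_ * _)).
by apply: eq_bigr => j _; rewrite mxE expr2.
Qed.

Lemma continuous_sqnormB x : continuous (fun theta => sqnorm (x - theta)).
Proof.
rewrite (_ : (fun _ => _) = fun theta => \sum_j (x j ord0 - theta j ord0) ^+ 2).
  apply: continuous_big => [|j _ theta]; first exact: add_continuous.
  apply: (@continuous_comp _ _ _ (fun t : 'cV[R]_d => x j ord0 - t j ord0)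
    (fun y => y ^+ 2)); last exact: exprn_continuous.
  by apply: continuousB; [exact: cst_continuous | exact: coord_continuous].
by apply/funext => theta; apply: eq_bigr => j _; rewrite !mxE.
Qed.

Lemma continuous_gaussian_densityB v x :
  continuous (fun theta => gaussian_density v%:M (x - theta)).
Proof.
pose g r := gaussian_peak v * expR (- (2 * v)^-1 * r).
rewrite (_ : (fun _ => _) = g \o (fun theta => sqnorm (x - theta))).
  move=> theta; apply: continuous_comp; first exact: continuous_sqnormB.
  apply: continuousM; first exact: cst_continuous.
  apply: continuous_comp; first exact: mulrl_continuous.
  exact: continuous_expR.
by apply/funext => theta; rewrite gaussian_density_scalar.
Qed.

Lemma gaussian_density_integrable (P : borel_prob R d) v x : 0 < v ->
  P.-integrable setT
    (EFin \o (fun theta : borelRd R d =>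
       gaussian_density v%:M (x - (theta : 'cV[R]_d)))).
Proof.
move=> v0; apply: measurable_bounded_integrable => //.
- by rewrite [X in (X < _)%E]probability_setT ltry.
- apply: continuous_borel_measurable; exact: continuous_gaussian_densityB.
- exists (gaussian_peak v); split; first exact: num_real.
  move=> M pM t _ /=; rewrite gaussian_density_scalar.
  rewrite ger0_norm ?mulr_ge0 ?expR_ge0// ?ltW ?gaussian_peak_gt0//.
  apply: le_lt_trans pM; rewrite ger_pMr ?gaussian_peak_gt0//.
  rewrite -[leRHS]expR0 ler_expR mulNr oppr_le0 mulr_ge0 ?sqnorm_ge0//.
  by rewrite invr_ge0 mulr_ge0// ltW.
Qed.

Lemma gaussian_density_gt0 v x : 0 < v -> 0 < gaussian_density v%:M x.
Proof.
move=> v0; rewrite gaussian_density_scalar.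
by rewrite mulr_gt0 ?expR_gt0// gaussian_peak_gt0.
Qed.

End gaussian.

(** * The maximal likelihood for the triangle *)

Section triangle.
Context {R : realType}.
Local Notation L := (@ln R 2).
Local Notation X := (@triangle R).

Lemma sigma2E : sigma2 = 3 / (8 * L) :> R.
Proof.
rewrite /sigma2; have -> : 256 = 2 ^+ 8 :> R by rewrite -natrX; congr _%:R.
by rewrite lnXn//; congr (_ / _); rewrite mulr_natl.
Qed.

Lemma sigma2_gt0 : 0 < sigma2 :> R.
Proof. by rewrite sigma2E divr_gt0// mulr_gt0// ln2_gt0. Qed.

Lemma sqnorm2 (x : 'cV[R]_2) : sqnorm x = x 0 0 ^+ 2 + x 1 0 ^+ 2.
Proof.
rewrite /sqnorm 2!big_ord_recl big_ord0 addr0.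
by congr (_ + x _ _ ^+ 2); apply/val_inj.
Qed.

Lemma sqrt3_sqr : Num.sqrt 3 ^+ 2 = 3 :> R.
Proof. by rewrite sqr_sqrtr. Qed.

Lemma triangle_gaussE i x :
  gaussian_density (triangle_cov i) x =
  gaussian_peak (d := 2) sigma2 * expR (- (4 / 3 * L) * sqnorm x).
Proof.
have L0 := @ln2_gt0 R.
have tau : (2 * sigma2)^-1 = 4 / 3 * L.
  by rewrite sigma2E; field; rewrite gt_eqF.
by rewrite /triangle_cov gaussian_density_scalar tau.
Qed.

Lemma sum_triangle_gauss_le (theta : 'cV[R]_2) :
  \sum_i expR (- (4 / 3 * L) * sqnorm (X i - theta)) <=
  3 * expR (- (4 / 3 * L)).
Proof.
have L0 := @ln2_gt0 R; have s3 := sqrt3_sqr.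
pose s := Num.sqrt 3 : R; pose a := theta 0 0; pose b := theta 1 0.
pose x := 8 / 3 * L * b.
pose y := 8 / 3 * L * (s / 2 * a - b / 2).
pose z := 8 / 3 * L * (- (s / 2) * a - b / 2).
(* [c] collects what the three exponents share, as [|X_i - theta|^2 = 1 + |theta|^2 - 2 <X_i,
   theta>]. *)
pose c := - (4 / 3 * L) * (1 + (a ^+ 2 + b ^+ 2)).
have xyz : x + y + z = 0 by rewrite /x /y /z; field.
have -> : \sum_i expR (- (4 / 3 * L) * sqnorm (X i - theta)) =
    expR c * (expR x + expR y + expR z).
  rewrite 3!big_ord_recl big_ord0 addr0 addrA !mulrDr -!expRD.
  rewrite !sqnorm2 /triangle /= !mxE /= -/a -/b -/s.
  congr (expR _ + expR _ + expR _); rewrite /c /x /y /z.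
  - by field.
  - transitivity (- (4 / 3 * L) *
      (s ^+ 2 / 4 + 4^-1 + (a ^+ 2 + b ^+ 2) - (s * a - b))); first by field.
    by rewrite s3; field.
  - transitivity (- (4 / 3 * L) *
      (s ^+ 2 / 4 + 4^-1 + (a ^+ 2 + b ^+ 2) + (s * a + b))); first by field.
    by rewrite s3; field.
(* The squares of [<X_i, theta>] sum to [3/2 |theta|^2], so this exponent cancels the [|theta|^2]
   term of [c]. *)
have xyz2 : (x ^+ 2 + y ^+ 2 + z ^+ 2) / (8 * L) =
    4 / 3 * L * (a ^+ 2 + b ^+ 2).
  transitivity (8 / 9 * L * (b ^+ 2 + (s ^+ 2 * a ^+ 2 + b ^+ 2) / 2)).
    by rewrite /x /y /z; field; rewrite gt_eqF.
  by rewrite s3; field.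
apply: le_trans (ler_wpM2l (expR_ge0 c) (sum_expR_le_gauss _ _ _ xyz)) _.
rewrite mulrCA -expRD xyz2 /c ler_pM2l// ler_expR; lra.
Qed.

(** The [X_i] are unit vectors with pairwise inner products -1/2. *)
Lemma sqnorm_triangleB_half i j :
  sqnorm (X i - 2^-1 *: X j) = if i == j then 4^-1 else 7 / 4.
Proof.
have s3 := sqrt3_sqr; rewrite sqnorm2.
case: i => -[|[|[|//]]] /= ?; case: j => -[|[|[|//]]] /= ?.
all: by rewrite /= !mxE/=; lra.
Qed.

Lemma sqnorm_triangle i : sqnorm (X i) = 1.
Proof.
have s3 := sqrt3_sqr; rewrite sqnorm2.
by case: i => -[|[|[|//]]] /= ?; rewrite /= !mxE/=; lra.
Qed.


(** The Gaussian density at distance 1 from its center, hence the density of [delta_0] at each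
    [X_i]. *)
Definition likelihood_max : R :=
  gaussian_peak (d := 2) sigma2 * expR (- (4 / 3 * L)).

Lemma likelihood_max_gt0 : 0 < likelihood_max.
Proof. by rewrite mulr_gt0 ?expR_gt0// gaussian_peak_gt0// sigma2_gt0. Qed.

Lemma loglik_le (H : borel_prob R 2) :
  loglik X triangle_cov H <= ln likelihood_max.
Proof.
rewrite /loglik -ler_pdivlMl ?invr_gt0// invrK.
apply: sum_ln_Rintegral_le => [|i|i x|x].
- exact: likelihood_max_gt0.
- exact/gaussian_density_integrable/sigma2_gt0.
- exact/gaussian_density_gt0/sigma2_gt0.
- under eq_bigr do rewrite triangle_gaussE.
  rewrite -mulr_sumr mulrCA ler_pM2l ?gaussian_peak_gt0 ?sigma2_gt0//.
  exact: sum_triangle_gauss_le.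
Qed.

Lemma Ghat_probability (alpha : R) : 0 <= alpha <= 1 ->
  exists2 P : borel_prob R 2, (P : set _ -> _) = Ghat alpha &
    forall f : borelRd R 2 -> R,
    measurable_fun setT f -> (forall x, 0 <= f x) ->
    \int[P]_x f x = alpha * f (0 : 'cV[R]_2) +
      (1 - alpha) * (3^-1 * \sum_i f (2^-1 *: X i)).
Proof.
move=> /andP[a0 a1].
have a1' : 0 <= 1 - alpha by rewrite subr_ge0.
have t0 : 0 <= 3^-1 :> R by [].
pose delta (x : 'cV[R]_2) := @dirac _ (borelRd R 2) x R.
(* [msum] indexes measures by [nat], hence [inord]. *)
pose m : measure (borelRd R 2) R := measure_add (mscale (NngNum a0) (delta 0))
  (mscale (NngNum a1') (mscale (NngNum t0)
    (msum (fun k => delta (2^-1 *: X (inord k))) 3))).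
have mE : (m : set _ -> _) = Ghat alpha.
  apply/funext => A; apply: etrans (measure_addE _ _ A) _.
  rewrite /msum/= /Ghat.
  congr (_ + _ * (_ * _))%E.
  by apply: eq_bigr => i _; rewrite inord_val.
have m1 : m setT = 1%E.
  rewrite mE /Ghat diracT; under eq_bigr do rewrite diracT.
  by rewrite sumEFin sumr_const card_ord -!EFinM -EFinD; congr EFin; field.
have [P Pm] := probability_measure _ _ _ m1.
exists P => [|f mf f0]; first by rewrite Pm.
move/measurable_EFinP: (mf) => mEf.
have f0E x : True -> (0 <= (f x)%:E)%E by rewrite lee_fin f0.
have -> : \int[P]_x f x = fine (\int[m]_x (f x)%:E).
  exact: (congr1 (fun mu => fine (integral mu setT (EFin \o f))) Pm).
have -> : (\int[m]_x (f x)%:E = alpha%:E * (f (0 : 'cV[R]_2))%:E +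
    (1 - alpha)%:E * (3^-1%:E * \sum_(i < 3) (f (2^-1 *: X i))%:E))%E.
  rewrite /m/= ge0_integral_measure_add//.
  rewrite !ge0_integral_mscale//.
  rewrite ge0_integral_measure_sum// integral_dirac// diracT mul1e.
  congr (_ + _ * (_ * _))%E; apply: eq_bigr => i _.
  by rewrite integral_dirac// diracT mul1e inord_val.
by rewrite sumEFin -!EFinM -EFinD.
Qed.

(** [alpha] drops out because both components have the same density at [X_i]. Up to [gaussian_peak]
    and with [e = exp (- L / 3)], it is [e / 2] for [delta_0] and [(e + 2 * (e / 4)) / 3 = e / 2]
    for the average. *)
Lemma loglik_Ghat (P : borel_prob R 2) alpha :
  (forall f : borelRd R 2 -> R, measurable_fun setT f -> (forall x, 0 <= f x) ->
    \int[P]_x f x = alpha * f (0 : 'cV[R]_2) +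
      (1 - alpha) * (3^-1 * \sum_i f (2^-1 *: X i))) ->
  loglik X triangle_cov P = ln likelihood_max.
Proof.
move=> Pf; rewrite /loglik.
suff fmax i : mixture_density P (triangle_cov i) (X i) = likelihood_max.
  under eq_bigr do rewrite fmax.
  by rewrite sumr_const card_ord -[ln _ *+ _]mulr_natl mulKf ?pnatr_eq0.
rewrite /mixture_density Pf; last 2 first.
- apply: continuous_borel_measurable; exact: continuous_gaussian_densityB.
- by move=> x; exact/ltW/gaussian_density_gt0/sigma2_gt0.
rewrite subr0.
under eq_bigr do rewrite triangle_gaussE sqnorm_triangleB_half.
rewrite triangle_gaussE sqnorm_triangle mulr1 -/likelihood_max.
rewrite -mulr_sumr (bigD1 i)//= eqxx.
rewrite (eq_bigr (fun=> expR (- (4 / 3 * L) * (7 / 4)))); last first.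
  by move=> j ji; rewrite eq_sym (negbTE ji).
rewrite sumr_const cardC1 card_ord/=.
have e2 : expR L = 2 by rewrite lnK ?posrE.
pose e := expR (- (4 / 3 * L) * 4^-1).
have -> : expR (- (4 / 3 * L) * (7 / 4)) = e / (expR L * expR L).
  by rewrite -expRD -expRN -expRD; congr expR; field.
have eE : expR (- (4 / 3 * L)) = e / expR L.
  by rewrite -expRN -expRD; congr expR; field.
by rewrite /likelihood_max eE -/e e2; field.
Qed.

End triangle.

(** * The maximizers and their infinitude *)

Theorem lemma2 (R : realType) :
  infinite_set [set on_borel G | G in maximizers (@triangle R) triangle_cov]
  /\ forall alpha : R, 0 <= alpha <= 1 ->
     exists2 G : borel_prob R 2,
       (forall A : set (borelRd R 2), measurable A -> G A = Ghat alpha A)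
       & maximizers triangle triangle_cov G.
Proof.
have Ghat_max (alpha : R) : 0 <= alpha <= 1 ->
    exists2 G : borel_prob R 2,
      (forall A : set (borelRd R 2), measurable A -> G A = Ghat alpha A)
      & maximizers triangle triangle_cov G.
  move=> /Ghat_probability[G GE Gf]; exists G => [A _|H]; first by rewrite GE.
  by rewrite (loglik_Ghat _ _ Gf) loglik_le.
split=> // maxfin.
(* A ball that contains 0 but no [X_i / 2], whose squared norm is 1/4; its mass therefore recovers
   [alpha]. *)
pose B : set (borelRd R 2) :=
  [set theta : 'cV[R]_2 | sqnorm (0 - theta) < 8^-1].
have mB : measurable B.
  apply: borel_open; rewrite /B -[X in open X]/(_ @^-1` [set y | y < 8^-1]).
  have /continuousP := @continuous_sqnormB R 2 0; apply.
  by rewrite -set_itvE; exact: lray_open.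
have GhatB (alpha : R) : Ghat alpha B = alpha%:E.
  rewrite /Ghat diracE mem_set/=; last first.
    by rewrite /B/= sqnorm2 !mxE; lra.
  rewrite big1 ?mule0 ?adde0 ?mule1// => i _.
  rewrite diracE memNset//= /B/=; apply/negP; rewrite -leNgt.
  have := @sqnorm_triangle R i; rewrite !sqnorm2 !mxE; lra.
(* Finitely many maximizers would give [B] finitely many masses, but every [1 / (n + 1)] occurs. *)
pose V := [set on_borel G B | G in maximizers (@triangle R) triangle_cov].
have Vfin : finite_set V.
  have := finite_image (fun m : set (borelRd R 2) -> \bar R => m B) maxfin.
  by rewrite image_comp.
apply: infinite_nat.
pose g (n : nat) : \bar R := (n.+1%:R^-1 : R)%:E.
have -> : [set: nat] = g @^-1` V.
  apply/seteqP; split => // n _.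
  have [|G GE Gmax] := Ghat_max n.+1%:R^-1.
    by rewrite invr_ge0 ler0n/= invf_le1// ler1n.
  by exists G => //; rewrite /on_borel patchE mem_set// GE// GhatB.
apply: finite_preimage Vfin => n m _ _ [] /invr_inj /eqP.
by rewrite eqr_nat => /eqP[].
Qed.
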